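(* Let $(R,\mathfrak m)$ be a commutative Noetherian local ring and let $I$ be a trace ideal of $R$ containing a regular element. Then $\mathrm{Ann}_R\big(\mathrm{Ext}^1_R(R/I,R)\big)\supseteq\mathfrak C_R$. In particular, if $\mathfrak C_R=\mathfrak m$ and $\mathrm{ht}(I)=1$, then $D(I)=\mathfrak m$.
   Context: The trace ideal of a module $M$ is $\mathrm{tr}(M)=\sum_{f\in\mathrm{Hom}_R(M,R)}f(M)$; an ideal $I$ is a trace ideal if $I=\mathrm{tr}(M)$ for some module $M$ (equivalently $I=\mathrm{tr}(I)$). $\overline{R}$ is the integral closure of $R$ in its total ring of fractions and $\mathfrak C_R=\mathrm{Ann}_R(\overline{R}/R)$ is the conductor. For an ideal $I$ of grade $g$, $D(I):=\mathrm{Ann}_R(\mathrm{Ext}^g_R(R/I,R))$. *)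

(* Defs.v *)
From HB Require Import structures.
From mathcomp Require Import all_boot all_order all_algebra.
From mathcomp Require Import generic_quotient ring_quotient.
From mathcomp Require Import boolp classical_sets cardinality functions.
From mathcomp Require Import freeg.
From mathcomp Require Import ring.

Set Implicit Arguments.
Unset Strict Implicit.
Unset Printing Implicit Defensive.

Import GRing.Theory.
Local Open Scope ring_scope.
Local Open Scope quotient_scope.

(* Submodules of an R-module V are the library's [submodClosed V]; they are
   boolean predicates, propositional ones being turned into such by [asbool]
   (notation `[< _ >]).  Ideals of R are the submodules of R^o. *)
Notation ideal R := (submodClosed R^o).

Section Modules.
Variables (R : comNzRingType) (V : lmodType R).

Section Submodule.
Variable S : submodClosed V.

Record submod := Submod { submod_val : V; _ : submod_val \in S }.

HB.instance Definition _ := [isSub for submod_val].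
HB.instance Definition _ := [Choice of submod by <:].
HB.instance Definition _ := [SubChoice_isSubLmodule of submod by <:].

End Submodule.

Section QuotientModule.
Variable S : submodClosed V.

(* A [submodClosed] predicate is not canonically a [zmodClosed] one, which is
   what the quotient of ring_quotient.v expects. *)
Definition submod_pred : {pred V} := fun x => x \in S.

Lemma submod_pred_zmod : zmod_closed submod_pred.
Proof.
have SE x : (x \in submod_pred) = (x \in S) by [].
split=> [|x y]; rewrite !SE ?rpred0 // => xS yS.
by rewrite -scaleN1r rpredD ?rpredZ.
Qed.

HB.instance Definition _ :=
  GRing.isZmodClosed.Build V submod_pred submod_pred_zmod.

Definition quotmod := Quotient.quot submod_pred.

HB.instance Definition _ := GRing.Zmodule.on quotmod.
HB.instance Definition _ := Quotient.on quotmod.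

Lemma quotmodP (x y : V) :
  reflect (\pi_quotmod x = \pi_quotmod y) (x - y \in S).
Proof.
have E := Quotient.idealrBE submod_pred x y.
by apply: (iffP idP) => [h|/eqP]; [apply/eqP; rewrite -E | rewrite -E].
Qed.

Lemma pi_quotmodD (x y : V) :
  \pi_quotmod (x + y) = \pi_quotmod x + \pi_quotmod y.
Proof. exact: (@Quotient.pi_add _ submod_pred). Qed.

Definition quotmod_scale (a : R) (q : quotmod) : quotmod :=
  \pi_quotmod (a *: repr q).

Lemma pi_quotmodZ (a : R) (x : V) :
  \pi_quotmod (a *: x) = quotmod_scale a (\pi_quotmod x).
Proof.
apply/quotmodP; rewrite -scalerBr rpredZ //.
by apply/quotmodP; rewrite reprK.
Qed.

Lemma quotmod_scaleA a b q :
  quotmod_scale a (quotmod_scale b q) = quotmod_scale (a * b) q.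
Proof. by elim/quotW: q => x; rewrite -(pi_quotmodZ b x) -!pi_quotmodZ scalerA. Qed.

Lemma quotmod_scale1 : left_id 1 quotmod_scale.
Proof. by elim/quotW=> x; rewrite -!pi_quotmodZ scale1r. Qed.

Lemma quotmod_scaleDr : right_distributive quotmod_scale +%R.
Proof.
move=> a; elim/quotW=> x; elim/quotW=> y.
by rewrite -pi_quotmodD -!pi_quotmodZ scalerDr pi_quotmodD.
Qed.

Lemma quotmod_scaleDl q : {morph quotmod_scale^~ q : a b / a + b}.
Proof.
move=> a b; elim/quotW: q => x.
by rewrite -!pi_quotmodZ scalerDl pi_quotmodD.
Qed.

HB.instance Definition _ := GRing.Zmodule_isLmodule.Build R quotmod
  quotmod_scaleA quotmod_scale1 quotmod_scaleDr quotmod_scaleDl.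

End QuotientModule.
End Modules.

Section Subquotient.
Variables (R : comNzRingType) (V : lmodType R) (Z B : submodClosed V).

Definition restr_submod : {pred submod Z} := fun z => val z \in B.

Lemma restr_submod_closed : subsemimod_closed restr_submod.
Proof.
have BE z : (z \in restr_submod) = (val z \in B) by [].
split; first split; rewrite ?BE ?raddf0 ?rpred0 // => a x.
  by rewrite !BE raddfD; apply: rpredD.
by rewrite !BE linearZ; apply: rpredZ.
Qed.

HB.instance Definition _ :=
  GRing.isSubmodClosed.Build R (submod Z) restr_submod restr_submod_closed.

(* Z / (Z :&: B), i.e. Z / B when B is contained in Z *)
Definition subquot := quotmod restr_submod.
HB.instance Definition _ := GRing.Lmodule.on subquot.

End Subquotient.

Section Annihilator.
Variables (R : comNzRingType) (M : lmodType R).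

Definition Ann : {pred R^o} := fun a => `[< forall x : M, a *: x = 0 >].

Lemma Ann_closed : subsemimod_closed Ann.
Proof.
split; first split; rewrite ?unfold_in /Ann.
- by apply/asboolP => x; rewrite scale0r.
- by move=> a b /asboolP aP /asboolP bP; apply/asboolP => x;
    rewrite scalerDl aP bP addr0.
- by move=> a b /asboolP bP; apply/asboolP => x; rewrite -scalerA bP scaler0.
Qed.

HB.instance Definition _ := GRing.isSubmodClosed.Build R R^o Ann Ann_closed.

End Annihilator.

Section Trace.
Variables (R : comNzRingType) (M : lmodType R).

(* the sum of the images f(M), i.e. all finite sums of elements f(x) *)
Definition trace : {pred R^o} := fun a =>
  `[< exists s : seq ({linear M -> R^o} * M), a = \sum_(fx <- s) fx.1 fx.2 >].

Lemma trace_closed : subsemimod_closed trace.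
Proof.
split; first split; rewrite ?unfold_in /trace.
- by apply/asboolP; exists [::]; rewrite big_nil.
- move=> _ _ /asboolP[s ->] /asboolP[t ->]; apply/asboolP.
  by exists (s ++ t); rewrite big_cat.
- move=> a _ /asboolP[s ->]; apply/asboolP.
  exists [seq (fx.1, a *: fx.2) | fx <- s].
  by rewrite big_map scaler_sumr; apply: eq_bigr => fx _; rewrite linearZ.
Qed.

HB.instance Definition _ :=
  GRing.isSubmodClosed.Build R R^o trace trace_closed.

End Trace.

Definition trace_ideal (R : comNzRingType) (I : ideal R) : Prop :=
  exists M : lmodType R, I =i trace M.

(* Ext^n_R(M, N) is the cohomology of Hom_R(P, N), where P is the standard free
   resolution of M: P_n is the free module on the set of all elements of the
   n-th syzygy, the 0-th syzygy being M and the (n+1)-st one the kernel of the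
   canonical surjection of P_n onto the n-th one. *)
Section FreeCover.
Variables (R : comNzRingType) (M : lmodType R).

Definition free_cover : {freeg M / R} -> M := fglift id.

Lemma free_cover_linear : linear free_cover.
Proof.
have B : zmod_morphism free_cover := @lift_is_additive _ _ _ _.
pose fM := GRing.isZmodMorphism.Build _ _ free_cover B.
pose f : {additive _ -> _} := HB.pack free_cover fM.
have Z a D : free_cover (a *: D) = a *: free_cover D.
  have -> : a *: D = \sum_(x <- dom D) << a * coeff x D *g x >> by [].
  rewrite -[D in RHS]freeg_sumE -[LHS]/(f _) -[RHS]/(a *: f _).
  rewrite !raddf_sum.
  by apply: eq_bigr => x _; rewrite /= /free_cover !liftU scalerA.
by move=> a x y; rewrite -[LHS]/(f _) raddfD /= Z.
Qed.

HB.instance Definition _ :=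
  GRing.isLinear.Build R {freeg M / R} M *:%R free_cover free_cover_linear.

Definition free_ker : {pred {freeg M / R}} := fun D => free_cover D == 0.

Lemma free_ker_closed : subsemimod_closed free_ker.
Proof.
have KE D : (D \in free_ker) = (free_cover D == 0) by [].
split; first split; rewrite ?KE ?linear0 // => a x.
  by rewrite !KE linearD /= => /eqP-> /eqP->; rewrite addr0.
by rewrite !KE linearZ /= => /eqP->; rewrite scaler0.
Qed.

HB.instance Definition _ :=
  GRing.isSubmodClosed.Build R {freeg M / R} free_ker free_ker_closed.

End FreeCover.

Arguments free_ker {R} M.

Section Ext.
Variables (R : comNzRingType) (M N : lmodType R).

Fixpoint syzygy (n : nat) : lmodType R :=
  if n is n'.+1 then submod (free_ker (syzygy n')) else M.

Definition resolution (n : nat) : lmodType R := {freeg (syzygy n) / R}.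

Definition differential (n : nat) (x : resolution n.+1) : resolution n :=
  val (free_cover x).

Lemma differential_linear (n : nat) : linear (@differential n).
Proof. by move=> a x y; rewrite /differential !linearP. Qed.

Lemma free_cover_surj (K : lmodType R) (x : K) : exists D, free_cover D = x.
Proof. by exists << x >>; rewrite /free_cover liftU scale1r. Qed.

Lemma resolution_exact0 (x : resolution 0) :
  free_cover x = 0 <-> exists y : resolution 1, x = differential y.
Proof.
split=> [x0|[y ->]]; last by apply/eqP; exact: valP (free_cover y).
have xK : x \in free_ker M by apply/eqP.
by have [y yE] := free_cover_surj (Submod xK); exists y; rewrite /differential yE.
Qed.

Lemma resolution_exact (n : nat) (x : resolution n.+1) :
  differential x = 0 <-> exists y : resolution n.+2, x = differential y.
Proof.
split=> [x0|[y ->]]; last first.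
  rewrite /differential; have /eqP -> := valP (free_cover y).
  exact: raddf0.
have xK : x \in free_ker (syzygy n.+1).
  by apply/eqP/val_inj; rewrite -/(differential x) x0 raddf0.
by have [y yE] := free_cover_surj (Submod xK); exists y; rewrite /differential yE.
Qed.

(* f o d = 0, for f in Hom_R(P_n, N) *)
Definition cocycle (n : nat) : {pred (resolution n -> N)} := fun f =>
  `[< linear f /\ forall x : resolution n.+1, f (differential x) = 0 >].

Lemma cocycle_closed (n : nat) : subsemimod_closed (@cocycle n).
Proof.
have E f : (f \in @cocycle n) = `[< linear f /\
  forall x : resolution n.+1, f (differential x) = 0 >] by [].
split; first split; rewrite ?E.
- by apply/asboolP; split=> // a x y; rewrite scaler0 addr0.
- move=> f g; rewrite !E => /asboolP[fL fd] /asboolP[gL gd]; apply/asboolP.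
  split=> [a x y|x]; rewrite /= !fctE ?fd ?gd ?addr0 // fL gL scalerDr.
  by rewrite addrACA.
- move=> a f; rewrite !E => /asboolP[fL fd]; apply/asboolP.
  split=> [b x y|x]; rewrite /= !fctE ?fd ?scaler0 // fL scalerDr !scalerA.
  by rewrite mulrC.
Qed.

HB.instance Definition _ (n : nat) := GRing.isSubmodClosed.Build R
  (resolution n -> N) (@cocycle n) (@cocycle_closed n).

Definition coboundary (n : nat) : {pred (resolution n -> N)} :=
  match n with
  | 0 => fun f => f == 0
  | n'.+1 => fun f => `[< exists2 g : resolution n' -> N,
      linear g & forall x, f x = g (differential x) >]
  end.

Lemma coboundary_closed (n : nat) : subsemimod_closed (@coboundary n).
Proof.
case: n => [|n].
  have E f : (f \in @coboundary 0) = (f == 0) by [].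
  split; first split; rewrite ?E // => a f; rewrite !E.
    by move=> /eqP -> /eqP ->; rewrite addr0.
  by move=> /eqP ->; rewrite scaler0.
have E f : (f \in @coboundary n.+1) = `[< exists2 g : resolution n -> N,
      linear g & forall x, f x = g (differential x) >] by [].
split; first split; rewrite ?E.
- apply/asboolP; exists 0 => // a x y; by rewrite scaler0 addr0.
- move=> u v; rewrite !E => /asboolP[f fL fE] /asboolP[g gL gE].
  apply/asboolP; exists (f + g) => [a x y|x]; rewrite /= !fctE ?fE ?gE //.
  by rewrite fL gL scalerDr addrACA.
- move=> a u; rewrite !E => /asboolP[f fL fE].
  apply/asboolP; exists (a *: f) => [b x y|x]; rewrite /= !fctE ?fE //.
  by rewrite fL scalerDr !scalerA mulrC.
Qed.

HB.instance Definition _ (n : nat) := GRing.isSubmodClosed.Build R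
  (resolution n -> N) (@coboundary n) (@coboundary_closed n).

Lemma coboundary_cocycle (n : nat) :
  {subset @coboundary n <= @cocycle n}.
Proof.
case: n => [f /eqP ->|n f /asboolP[g gL gE]]; apply/asboolP.
  by split=> // a x y; rewrite scaler0 addr0.
split=> [a x y|x]; first by rewrite !gE differential_linear gL.
rewrite gE (_ : differential _ = 0); last first.
  by apply/resolution_exact; exists x.
by have := gL (-1) 0 0; rewrite scaler0 addr0 scaleN1r addNr.
Qed.

Definition Ext (n : nat) : lmodType R := subquot (@cocycle n) (@coboundary n).

End Ext.

(* The total ring of fractions: pairs (a, s) with s a non-zero-divisor, modulo
   (a, s) ~ (b, t) iff a t = b s.  fraction.v only covers integral domains. *)
Section TotalFractions.
Variable R : comNzRingType.

Definition regular : {pred R} := fun x => `[< GRing.lreg x >].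

Lemma regularP x : reflect (GRing.lreg x) (x \in regular).
Proof. exact: asboolP. Qed.

Lemma regular1 : 1 \in regular.
Proof. by apply/regularP/lreg1. Qed.

Lemma regularM x y : x \in regular -> y \in regular -> x * y \in regular.
Proof. by move=> /regularP ? /regularP ?; apply/regularP/lregM. Qed.

Record ratio := Ratio { frac : R * R; _ : frac.2 \in regular }.

HB.instance Definition _ := [isSub for frac].
HB.instance Definition _ := [Choice of ratio by <:].

Local Notation num x := (frac x).1.
Local Notation den x := (frac x).2.

Definition mk_ratio (a s : R) (sR : s \in regular) : ratio :=
  @Ratio (a, s) sR.

Lemma den_regular (x : ratio) : den x \in regular. Proof. by case: x. Qed.

Definition equivf (x y : ratio) := num x * den y == num y * den x.

Lemma equivf_equiv : equiv_class_of equivf.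
Proof.
split=> [x|x y|y x z]; rewrite /equivf; [exact: eqxx|exact: eq_sym|].
move=> /eqP xy /eqP yz; apply/eqP/(regularP _ (den_regular y)).
transitivity (num x * den y * den z); first by ring.
by rewrite xy; transitivity (num y * den z * den x); [ring | rewrite yz; ring].
Qed.

Canonical equivf_equiv_rel := EquivRelPack equivf_equiv.
Canonical equivf_encModRel := defaultEncModRel equivf.

Definition totfrac := {eq_quot equivf}.

HB.instance Definition _ : EqQuotient _ equivf totfrac :=
  EqQuotient.on totfrac.
HB.instance Definition _ := Choice.on totfrac.

Lemma totfracP (x y : ratio) :
  reflect (\pi_totfrac x = \pi_totfrac y) (num x * den y == num y * den x).
Proof. by rewrite -/(equivf x y) -eqmodE; exact: eqP. Qed.

Lemma repr_totfrac (x : ratio) :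
  num (repr (\pi_totfrac x)) * den x = num x * den (repr (\pi_totfrac x)).
Proof. by apply/eqP/totfracP; rewrite reprK. Qed.

Definition addf (x y : ratio) : ratio :=
  mk_ratio (num x * den y + num y * den x)
    (regularM (den_regular x) (den_regular y)).
Definition oppf (x : ratio) : ratio := mk_ratio (- num x) (den_regular x).
Definition mulf (x y : ratio) : ratio :=
  mk_ratio (num x * num y) (regularM (den_regular x) (den_regular y)).

Definition tofrac (a : R) : totfrac := \pi_totfrac (mk_ratio a regular1).
Definition totfrac_add (p q : totfrac) : totfrac :=
  \pi_totfrac (addf (repr p) (repr q)).
Definition totfrac_opp (p : totfrac) : totfrac := \pi_totfrac (oppf (repr p)).
Definition totfrac_mul (p q : totfrac) : totfrac :=
  \pi_totfrac (mulf (repr p) (repr q)).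

Lemma pi_addf x y :
  totfrac_add (\pi_totfrac x) (\pi_totfrac y) = \pi_totfrac (addf x y).
Proof.
apply/totfracP/eqP => /=; move: (repr_totfrac x) (repr_totfrac y).
set x' := repr _; set y' := repr _ => hx hy.
transitivity (num x' * den x * (den y' * den y) +
  num y' * den y * (den x' * den x)); first by ring.
by rewrite hx hy; ring.
Qed.

Lemma pi_oppf x : totfrac_opp (\pi_totfrac x) = \pi_totfrac (oppf x).
Proof. by apply/totfracP/eqP; rewrite /= !mulNr repr_totfrac. Qed.

Lemma pi_mulf x y :
  totfrac_mul (\pi_totfrac x) (\pi_totfrac y) = \pi_totfrac (mulf x y).
Proof.
by apply/totfracP/eqP; rewrite /= mulrACA !repr_totfrac mulrACA.
Qed.

Lemma totfrac_addA : associative totfrac_add.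
Proof.
elim/quotW=> x; elim/quotW=> y; elim/quotW=> z.
rewrite (pi_addf y z) (pi_addf x y) !pi_addf.
by apply/totfracP/eqP => /=; ring.
Qed.

Lemma totfrac_addC : commutative totfrac_add.
Proof.
elim/quotW=> x; elim/quotW=> y; rewrite !pi_addf.
by apply/totfracP/eqP => /=; ring.
Qed.

Lemma totfrac_add0 : left_id (tofrac 0) totfrac_add.
Proof. by elim/quotW=> x; rewrite pi_addf; apply/totfracP/eqP => /=; ring. Qed.

Lemma totfrac_addN : left_inverse (tofrac 0) totfrac_opp totfrac_add.
Proof.
elim/quotW=> x; rewrite (pi_oppf x) pi_addf.
by apply/totfracP/eqP => /=; ring.
Qed.

HB.instance Definition _ := GRing.isZmodule.Build totfrac
  totfrac_addA totfrac_addC totfrac_add0 totfrac_addN.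

Lemma totfrac_mulA : associative totfrac_mul.
Proof.
elim/quotW=> x; elim/quotW=> y; elim/quotW=> z.
rewrite (pi_mulf y z) (pi_mulf x y) !pi_mulf.
by apply/totfracP/eqP => /=; ring.
Qed.

Lemma totfrac_mulC : commutative totfrac_mul.
Proof.
elim/quotW=> x; elim/quotW=> y; rewrite !pi_mulf.
by apply/totfracP/eqP => /=; ring.
Qed.

Lemma totfrac_mul1 : left_id (tofrac 1) totfrac_mul.
Proof. by elim/quotW=> x; rewrite pi_mulf; apply/totfracP/eqP => /=; ring. Qed.

Lemma totfrac_mulDl : left_distributive totfrac_mul totfrac_add.
Proof.
elim/quotW=> x; elim/quotW=> y; elim/quotW=> z.
rewrite (pi_addf x y) (pi_mulf x z) (pi_mulf y z) pi_addf pi_mulf.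
by apply/totfracP/eqP => /=; ring.
Qed.

Lemma tofrac_inj : injective tofrac.
Proof. by move=> a b /totfracP/eqP; rewrite /= !mulr1. Qed.

Lemma totfrac_one_neq0 : tofrac 1 != tofrac 0.
Proof. by apply/eqP => /tofrac_inj/eqP; rewrite oner_eq0. Qed.

HB.instance Definition _ := GRing.Zmodule_isComNzRing.Build totfrac
  totfrac_mulA totfrac_mulC totfrac_mul1 totfrac_mulDl totfrac_one_neq0.

Lemma tofrac_is_zmod_morphism : zmod_morphism tofrac.
Proof.
move=> a b; rewrite -[RHS]/(totfrac_add (tofrac a) (totfrac_opp (tofrac b))).
rewrite (pi_oppf (mk_ratio b regular1)) pi_addf.
by apply/totfracP/eqP => /=; ring.
Qed.

Lemma tofrac_is_monoid_morphism : monoid_morphism tofrac.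
Proof.
split=> // a b; rewrite -[RHS]/(totfrac_mul (tofrac a) (tofrac b)) pi_mulf.
by apply/totfracP/eqP => /=; ring.
Qed.

HB.instance Definition _ :=
  GRing.isZmodMorphism.Build R totfrac tofrac tofrac_is_zmod_morphism.
HB.instance Definition _ :=
  GRing.isMonoidMorphism.Build R totfrac tofrac tofrac_is_monoid_morphism.

Lemma tofrac_regular (s : R) : GRing.lreg s -> exists q, tofrac s * q = 1.
Proof.
move=> /regularP sR; exists (\pi_totfrac (mk_ratio 1 sR)).
rewrite -[LHS]/(totfrac_mul (tofrac s) _) pi_mulf.
by apply/totfracP/eqP => /=; ring.
Qed.

Lemma totfrac_surj (q : totfrac) :
  exists a s : R, GRing.lreg s /\ q * tofrac s = tofrac a.
Proof.
elim/quotW: q => x; exists (num x), (den x); split.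
  exact/regularP/den_regular.
rewrite -[LHS]/(totfrac_mul (\pi_totfrac x) (tofrac (den x))) pi_mulf.
by apply/totfracP/eqP => /=; ring.
Qed.

Definition totfrac_scale (a : R) (q : totfrac) : totfrac := tofrac a * q.

Lemma totfrac_scaleA a b q :
  totfrac_scale a (totfrac_scale b q) = totfrac_scale (a * b) q.
Proof. by rewrite /totfrac_scale rmorphM mulrA. Qed.

Lemma totfrac_scale1 : left_id 1 totfrac_scale.
Proof. by move=> q; rewrite /totfrac_scale rmorph1 mul1r. Qed.

Lemma totfrac_scaleDr : right_distributive totfrac_scale +%R.
Proof. by move=> a p q; rewrite /totfrac_scale mulrDr. Qed.

Lemma totfrac_scaleDl q : {morph totfrac_scale^~ q : a b / a + b}.
Proof. by move=> a b; rewrite /totfrac_scale rmorphD mulrDl. Qed.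

HB.instance Definition _ := GRing.Zmodule_isLmodule.Build R totfrac
  totfrac_scaleA totfrac_scale1 totfrac_scaleDr totfrac_scaleDl.

Definition integral_closure : {pred totfrac} :=
  fun q => `[< integralOver tofrac q >].

Lemma integral_closure_closed : subsemimod_closed integral_closure.
Proof.
have E q : (q \in integral_closure) = `[< integralOver tofrac q >] by [].
split; first split; rewrite ?E.
- by apply/asboolP/integral0.
- move=> p q; rewrite !E => /asboolP ? /asboolP ?.
  exact/asboolP/integral_add.
- move=> a q; rewrite !E => /asboolP ?.
  by apply/asboolP/integral_mul => //; exact: integral_id.
Qed.

HB.instance Definition _ := GRing.isSubmodClosed.Build R totfrac
  integral_closure integral_closure_closed.

(* the image of R in its total ring of fractions *)
Definition base_ring : {pred totfrac} :=
  fun q => `[< exists a : R, q = tofrac a >].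

Lemma base_ring_closed : subsemimod_closed base_ring.
Proof.
have E q : (q \in base_ring) = `[< exists a : R, q = tofrac a >] by [].
split; first split; rewrite ?E.
- by apply/asboolP; exists 0; rewrite raddf0.
- move=> p q; rewrite !E => /asboolP[a ->] /asboolP[b ->].
  by apply/asboolP; exists (a + b); rewrite raddfD.
- move=> c q; rewrite !E => /asboolP[a ->].
  by apply/asboolP; exists (c * a); rewrite rmorphM.
Qed.

HB.instance Definition _ := GRing.isSubmodClosed.Build R totfrac
  base_ring base_ring_closed.

Lemma base_ring_integral : {subset base_ring <= integral_closure}.
Proof. by move=> q /asboolP[a ->]; apply/asboolP/integral_id. Qed.

Definition conductor : {pred R^o} := Ann (subquot integral_closure base_ring).

End TotalFractions.

Section Ideals.
Variable R : comNzRingType.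
Implicit Types I J P : ideal R.

Definition ideal_gen (s : seq R) : {pred R} := fun x =>
  `[< exists c : nat -> R, x = \sum_(i < size s) c i * s`_i >].

Definition noetherian : Prop :=
  forall J, exists s : seq R, J =i ideal_gen s.

Definition maximal_ideal J : Prop :=
  1 \notin J /\ forall J', {subset J <= J'} -> 1 \notin J' -> {subset J' <= J}.

Definition local_ring (m : ideal R) : Prop :=
  maximal_ideal m /\ forall J, maximal_ideal J -> J =i m.

Definition prime_ideal P : Prop :=
  1 \notin P /\ forall x y : R, x * y \in P -> x \in P \/ y \in P.

(* a chain p 0 < ... < p n of prime ideals ending at P *)
Definition prime_chain P (n : nat) : Prop :=
  exists p : nat -> ideal R,
    [/\ p n =i P,
        forall i, (i <= n)%N -> prime_ideal (p i) &
        forall i, (i < n)%N -> {subset p i <= p i.+1} /\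
          exists2 x, x \in p i.+1 & x \notin p i].

Definition prime_height P (n : nat) : Prop :=
  prime_chain P n /\ forall k, prime_chain P k -> (k <= n)%N.

(* ht I = n: the minimum of the heights of the primes containing I, primes of
   infinite height having no [prime_height] *)
Definition has_height I (n : nat) : Prop :=
  (exists P, [/\ prime_ideal P, {subset I <= P} & prime_height P n]) /\
  forall P k, prime_ideal P -> {subset I <= P} -> prime_height P k -> (n <= k)%N.

Definition regular_seq (s : seq R) : Prop :=
  1 \notin ideal_gen s /\
  forall i, (i < size s)%N -> forall a : R,
    s`_i * a \in ideal_gen (take i s) -> a \in ideal_gen (take i s).

Definition has_grade I (n : nat) : Prop :=
  (exists s, [/\ regular_seq s, {subset s <= I} & size s = n]) /\
  forall s, regular_seq s -> {subset s <= I} -> (size s <= n)%N.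

(* The default value 0 is only reached when the lengths of the regular sequences
   in I are unbounded, which does not happen over a Noetherian ring. *)
Definition grade I : nat := xget 0%N (has_grade I).

Definition D I : {pred R^o} := Ann (Ext (quotmod I) R^o (grade I)).

End Ideals.

Arguments noetherian R : clear implicits.
Arguments conductor R : clear implicits.

(* Main.v *)
From HB Require Import structures.
From mathcomp Require Import all_boot all_algebra.
From mathcomp Require Import generic_quotient boolp classical_sets freeg ring.
Require Import Defs.

(** Applying [Hom(-, R)] to [0 -> I -> R -> R/I -> 0] shows that
    [Ext^1(R/I, R)] is the cokernel of [R -> Hom(I, R)]: a scalar [c] kills it
    exactly when [c f] is multiplication by an element of [R] for every
    [f : I -> R] ([Ann_Ext1_quotP]).

    Because [I] contains a regular element [x], every such [f] is
    multiplication by the fraction [q = f(x)/x] ([linear_on_frac]).  Because [I]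
    is a trace ideal, [f] maps [I] into itself ([trace_ideal_stable]), so
    [q I] is contained in [I]; as [I] is finitely generated and contains a
    regular element, the determinant trick makes [q] integral over [R]
    ([integral_of_stable]).  If [c] is in the conductor, then [c q] is in [R],
    and [c f] is multiplication by that element.  This is the first claim.

    For the second claim the conductor is the maximal ideal [m], hence proper,
    so there is an integral fraction [q] outside [R]; it satisfies
    [q m <= R], and the ideal [I], being contained in a prime, is proper and
    lies in [m].  This single fraction does two things.
    - A regular sequence [a, b] in [I] cannot exist ([no_regular_pair]), since
      regularity of [b] modulo [a] would force [q] into [R].  Hence [I] has
      grade 1, and [D(I)] is the annihilator of [Ext^1(R/I, R)].
    - Multiplication by [q] is a map [I -> R] that is not multiplication by an
      element of [R], so [Ext^1(R/I, R)] is nonzero ([Ext1_quot_neq0]).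
    Its annihilator is therefore a proper ideal, and it contains [m] by the
    first claim, so it is [m]. *)

Set Implicit Arguments.
Unset Strict Implicit.
Unset Printing Implicit Defensive.

Import GRing.Theory.
Local Open Scope ring_scope.
Local Open Scope quotient_scope.

(** * Bundling, annihilators of subquotients, and the conductor *)

(** Cochains are plain functions with a proof of linearity; this turns them
    into bundled linear maps, to which the linearity lemmas apply. *)
Lemma linear_bundle (R : comNzRingType) (V W : lmodType R) (f : V -> W) :
  linear f -> exists g : {linear V -> W}, g =1 f.
Proof.
move=> fL; pose fM := GRing.isLinear.Build R V W *:%R f fL.
by exists (HB.pack f fM : {linear V -> W}).
Qed.

Lemma pi_quotmod0 (R : comNzRingType) (V : lmodType R) (S : submodClosed V) :
  \pi_(quotmod S) 0 = 0.
Proof. by apply: (addrI (\pi 0)); rewrite -pi_quotmodD !addr0. Qed.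

Lemma Ann_subquotP (R : comNzRingType) (V : lmodType R) (Z B : submodClosed V)
    (a : R) :
  reflect {in Z, forall z, a *: z \in B} (a \in Ann (subquot Z B)).
Proof.
apply: (iffP (asboolP _)) => [aA z zZ|aZB x].
  have /(_ (\pi_(quotmod (@restr_submod R V Z B)) (Submod zZ))) := aA.
  rewrite -[_ *: _]pi_quotmodZ -pi_quotmod0 => /quotmodP.
  by rewrite subr0 unfold_in /restr_submod linearZ.
elim/quotW: x => z; rewrite -[_ *: _]pi_quotmodZ.
rewrite -pi_quotmod0.
apply/quotmodP; rewrite subr0 unfold_in /restr_submod linearZ.
by apply: aZB; exact: valP.
Qed.

Lemma conductorP (R : comNzRingType) (c : R) :
  reflect (forall q : totfrac R, integralOver (@tofrac R) q ->
             exists r : R, tofrac c * q = tofrac r)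
          (c \in conductor R).
Proof.
apply: (iffP (Ann_subquotP _ _ _)) => [h q /asboolP qi|h q /asboolP qi].
  exact: (asboolP _ (h q qi)).
by apply/asboolP/h.
Qed.

(** * Linear forms on an ideal *)

Section IdealHom.
Variables (R : comNzRingType) (I : ideal R).

(** A linear form on [I] is represented by any function on [R] extending it, so
    that it can be evaluated without carrying membership proofs. *)
Definition linear_on (f : R -> R) : Prop :=
  forall r a b, a \in I -> b \in I -> f (r * a + b) = r * f a + f b.

Lemma ideal0 : 0 \in I. Proof. exact: rpred0. Qed.
Lemma idealMl r a : a \in I -> r * a \in I.
Proof. by move=> aI; have := @rpredZ R R^o I r a aI. Qed.
Lemma idealMr r a : a \in I -> a * r \in I.
Proof. by rewrite mulrC; apply: idealMl. Qed.

Section LinearOn.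
Variables (f : R -> R) (fL : linear_on f).

Lemma linear_on0 : f 0 = 0.
Proof.
have := fL (-1) ideal0 ideal0; rewrite mulr0 addr0 => ->.
by rewrite mulN1r addNr.
Qed.

Lemma linear_onZ r a : a \in I -> f (r * a) = r * f a.
Proof. by move=> aI; rewrite -[r * a]addr0 fL ?ideal0 // linear_on0 addr0. Qed.

Lemma linear_onC a b : a \in I -> b \in I -> a * f b = b * f a.
Proof. by move=> aI bI; rewrite -!linear_onZ // mulrC. Qed.
End LinearOn.

(** If [g : M -> R] has image in [I = tr(M)], then [f \o g] is another linear
    form on [M], so its image also lies in the trace. *)
Lemma trace_ideal_stable (f : R -> R) : trace_ideal I -> linear_on f ->
  {in I, forall a, f a \in I}.
Proof.
move=> [M IM] fL a; rewrite IM => /asboolP[s ->].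
have gI (g : {linear M -> R^o}) x : g x \in I.
  rewrite IM; apply/asboolP; exists [:: (g, x)]; by rewrite big_seq1.
have fgI (g : {linear M -> R^o}) x : f (g x) \in I.
  have fgL : linear (fun y => f (g y) : R^o).
    by move=> r y z; rewrite linearP /=; exact: fL.
  by have [h <-] := linear_bundle fgL; exact: gI.
elim: s => [|[g x] s IHs]; first by rewrite big_nil linear_on0 ?ideal0.
rewrite big_cons /= -[g x](mul1r (g x : R)) fL ?gI //.
  by rewrite mul1r; apply: rpredD IHs; apply: fgI.
by elim/big_rec: _ => [|gx y _ yI]; [exact: ideal0 | apply: rpredD].
Qed.

End IdealHom.

(** * Linear maps on free modules *)

Section FreeModule.
Variables (R : comNzRingType) (K : choiceType) (N : lmodType R).

Lemma freeg_basisE (D : {freeg K / R}) :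
  D = \sum_(x <- dom D) coeff x D *: << x >>.
Proof.
rewrite -{1}[D]freeg_sumE; apply: eq_bigr => x _; apply/eqP/freeg_eqP => y.
by rewrite coeffZ !coeffU mul1r.
Qed.

Lemma fglift_linear (g : K -> N) : linear (fglift g : {freeg K / R} -> N).
Proof.
pose gB := GRing.isZmodMorphism.Build {freeg K / R} N (fglift g)
  (lift_is_additive g).
pose f : {additive {freeg K / R} -> N} := HB.pack (fglift g) gB.
have fZ a D : f (a *: D) = a *: f D.
  rewrite -[in RHS](freeg_sumE D) -[a *: D]/(fgscale a D) /fgscale !raddf_sum.
  by apply: eq_bigr => x _; rewrite /= !liftU scalerA.
by move=> a D E; rewrite -[LHS]/(f _) raddfD fZ.
Qed.

HB.instance Definition _ (g : K -> N) :=
  GRing.isLinear.Build R {freeg K / R} N *:%R (fglift g) (fglift_linear g).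

Lemma eq_linear_freeg (f g : {linear {freeg K / R} -> N}) :
  (forall x, f << x >> = g << x >>) -> f =1 g.
Proof.
move=> fg D; rewrite (freeg_basisE D) !linear_sum.
by apply: eq_bigr => x _; rewrite !linearZ /= fg.
Qed.

End FreeModule.

(** * Ext in terms of syzygies *)

Section ExtSyzygy.
Variables (R : comNzRingType) (M N : lmodType R).

(** A cocycle vanishes on the image of the differential, which is the kernel of
    the surjection of [P_n] onto the [n]-th syzygy; so it descends to the
    latter. *)
Lemma cocycle_factor n (f : resolution M n -> N) : f \in @cocycle R M N n ->
  exists phi : {linear syzygy M n -> N}, forall D, f D = phi (free_cover D).
Proof.
move=> /asboolP[fL fd].
have [g gE] := linear_bundle fL.
have fker D : free_cover D = 0 -> f D = 0.
  move=> D0; have DK : D \in free_ker (syzygy M n) by apply/eqP.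
  have [y yE] := free_cover_surj (Submod DK).
  by rewrite -(fd y) /differential yE.
have fE D E : free_cover D = free_cover E -> f D = f E.
  move=> DE; apply/eqP; rewrite -!gE -subr_eq0 -linearB gE.
  by rewrite fker // linearB /= DE subrr.
have coverU k : free_cover << k >> = k by rewrite /free_cover liftU scale1r.
have phiL : linear (fun k => f << k >>).
  move=> a x y; rewrite -!gE -linearP !gE; apply: fE.
  by rewrite linearP /= !coverU.
have [phi phiE] := linear_bundle phiL.
by exists phi => D; rewrite phiE; apply: fE; rewrite coverU.
Qed.

(** Dimension shifting: [Ext^(n+1)(M, N)] is the cokernel of the restriction
    map from [Hom(P_n, N)] to [Hom] of the [(n+1)]-st syzygy, a submodule of
    [P_n].  So [c] kills it when [c phi] always extends to [P_n]. *)
Lemma Ann_ExtSP n (c : R) :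
  c \in Ann (Ext M N n.+1) <->
  forall phi : {linear syzygy M n.+1 -> N},
    exists g : {linear resolution M n -> N}, forall k, c *: phi k = g (val k).
Proof.
split=> [/Ann_subquotP cA phi|cP].
  have : (fun D => phi (free_cover D)) \in @cocycle R M N n.+1.
    apply/asboolP; split=> [a x y|D]; first by rewrite !linearP.
    rewrite -[RHS](linear0 phi); congr (phi _).
    apply/eqP; exact: (valP (free_cover D)).
  move=> /cA/asboolP[g gL gE]; have [h hE] := linear_bundle gL.
  exists h => k; have [D <-] := free_cover_surj k.
  by rewrite hE -[val _]/(differential D) -gE.
apply/Ann_subquotP => f /cocycle_factor[phi phiE].
have [g gE] := cP phi; apply/asboolP; exists g; first exact: linearP.
by move=> D; rewrite -gE -phiE.
Qed.

End ExtSyzygy.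

(** * The first Ext of a cyclic module *)

Section Ext1.
Variables (R : comNzRingType) (I : ideal R).
Local Notation P0 := {freeg (quotmod I) / R}.
Local Notation pi := (\pi_(quotmod I)).

Lemma pi_quotmod_linear : linear (fun x : R^o => pi x : quotmod I).
Proof. by move=> a x y; rewrite pi_quotmodD pi_quotmodZ. Qed.

(** Lifting the identity of [R/I] to a map [P0 -> R] compares the standard
    resolution with [0 -> I -> R]: it sends the first syzygy into [I]. *)
Definition lift0 : {linear P0 -> R^o} :=
  fglift (fun y : quotmod I => repr y : R^o).

Lemma pi_lift0 D : pi (lift0 D) = free_cover D.
Proof.
have [p pE] := linear_bundle pi_quotmod_linear.
have := @eq_linear_freeg R (quotmod I) (quotmod I) (p \o lift0)
  (@free_cover R (quotmod I)).
move=> /(_ _ D) /=; rewrite pE; apply=> x.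
by rewrite pE /lift0 /= /free_cover !liftU !scale1r reprK.
Qed.

Lemma lift0_ker (k : submod (free_ker (quotmod I))) : lift0 (val k) \in I.
Proof.
have /eqP k0 := valP k.
by rewrite -[lift0 _]subr0; apply/quotmodP; rewrite pi_lift0 k0 pi_quotmod0.
Qed.

Local Notation e0 := (<< pi (1 : R^o) >> : P0).

(** [a |-> a *: e0] is the comparison map in the other direction, from [I] to
    the first syzygy. *)
Lemma scale_e0_ker (a : R) : a \in I -> a *: e0 \in free_ker (quotmod I).
Proof.
move=> aI; apply/eqP; rewrite linearZ /= /free_cover liftU scale1r.
rewrite -[_ *: _]pi_quotmodZ -pi_quotmod0; apply/quotmodP.
by rewrite subr0 [_ *: _]mulr1.
Qed.

Lemma sub_lift0_ker (D : P0) : D - lift0 D *: e0 \in free_ker (quotmod I).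
Proof.
apply/eqP; rewrite linearB linearZ /= -pi_lift0 /free_cover liftU scale1r.
by rewrite -[_ *: _]pi_quotmodZ [_ *: 1]mulr1 subrr.
Qed.

(** [Ext^1(R/I, R)] is the cokernel of [R -> Hom(I, R)].  The comparison maps
    [lift0] and [a |-> a *: e0] transport linear forms between [I] and the
    first syzygy. *)
Lemma Ann_Ext1_quotP (c : R) :
  c \in Ann (Ext (quotmod I) R^o 1) <->
  forall f : R -> R, linear_on I f ->
    exists r : R, {in I, forall a, c * f a = r * a}.
Proof.
split=> [/Ann_ExtSP cA f fL | cP].
  have phiL : linear (fun k : syzygy (quotmod I) 1 => f (lift0 (val k)) : R^o).
    by move=> a x y; rewrite !linearP /=; apply: fL; apply: lift0_ker.
  have [phi phiE] := linear_bundle phiL; have [g gE] := cA phi.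
  (* e0 lifts to u, which is 1 only modulo I: hence the second term of r. *)
  pose u : R := lift0 e0.
  have uI : 1 - u \in I.
    by apply/quotmodP; rewrite pi_lift0 /free_cover liftU scale1r.
  exists (g e0 + c * f (1 - u)) => a aI.
  have := gE (Submod (scale_e0_ker aI)).
  rewrite phiE /= !linearZ /= -/u => E.
  have -> : f a = a * f (1 - u) + f (a * u).
    by rewrite -fL ?idealMr //; congr f; ring.
  by rewrite mulrDr [c * f (a * u)]E /GRing.scale /=; ring.
apply/Ann_ExtSP => phi.
pose ker x : syzygy (quotmod I) 1 := insubd 0 x.
have kerK x : x \in free_ker (quotmod I) -> val (ker x) = x by exact: insubdK.
have fL : linear_on I (fun a => phi (ker (a *: e0))).
  move=> r a b aI bI; rewrite -[RHS](linearP phi); congr (phi _).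
  apply: val_inj; rewrite linearP /= !kerK ?scale_e0_ker //;
    last exact: rpredD (idealMl _ aI) bI.
  by rewrite scalerDl scalerA.
have [r rE] := cP _ fL.
(* Every D splits as an element of the syzygy plus a multiple of e0; c phi is
   kept on the first part and multiplication by r is used on the second. *)
have gL : linear (fun D : P0 =>
   c * phi (ker (D - lift0 D *: e0)) + r * lift0 D : R^o).
  move=> a D E; have -> : ker (a *: D + E - lift0 (a *: D + E) *: e0) =
    a *: ker (D - lift0 D *: e0) + ker (E - lift0 E *: e0).
    apply: val_inj; rewrite [RHS]linearP /= !kerK ?sub_lift0_ker //.
    by rewrite linearP /= scalerDl scalerBr scalerA opprD addrACA.
  by rewrite !linearP /= /GRing.scale /=; ring.
have [g gE] := linear_bundle gL.
exists g => k; rewrite gE.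
rewrite -rE ?lift0_ker // -mulrDr -linearD; congr (_ * phi _).
apply: val_inj; rewrite linearD /=.
by rewrite !kerK ?subrK ?sub_lift0_ker ?scale_e0_ker ?lift0_ker.
Qed.
End Ext1.

(** * Linear forms as fractions, and the conductor *)

Section TraceConductor.
Variables (R : comNzRingType) (I : ideal R).
Local Notation tofrac := (@tofrac R).

(** [x f(a) = f(x a) = a f(x)], so that [f(a) = (f(x)/x) a]. *)
Lemma linear_on_frac (x : R) (f : R -> R) :
  x \in I -> GRing.lreg x -> linear_on I f ->
  exists q : totfrac R, {in I, forall a, tofrac (f a) = q * tofrac a}.
Proof.
move=> xI xreg fL; have [y xy] := @tofrac_regular R _ xreg.
exists (tofrac (f x) * y) => a aI.
have /(congr1 tofrac) := linear_onC fL xI aI.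
rewrite !rmorphM /= => E; rewrite mulrAC [_ * tofrac a]mulrC -E.
by rewrite mulrAC xy mul1r.
Qed.

Lemma ideal_gen_mem (s : seq R) (i : 'I_(size s)) : s`_i \in ideal_gen s.
Proof.
apply/asboolP; exists (fun j => (j == i :> nat)%:R).
rewrite (bigD1 i) //= eqxx mul1r big1 ?addr0 // => j ji.
by rewrite -val_eqE in ji; rewrite (negPf ji) mul0r.
Qed.

(** Determinant trick: multiplication by [q] acts on the generators [s]
    through a matrix over [R], and [q] is a root of its characteristic
    polynomial, since [det (q - B)] kills every generator and hence kills the
    regular element [x]. *)
Lemma integral_of_stable (x : R) (s : seq R) (q : totfrac R) :
  GRing.lreg x -> x \in ideal_gen s ->
  (forall i : 'I_(size s),
    exists2 y, y \in ideal_gen s & q * tofrac s`_i = tofrac y) ->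
  integralOver tofrac q.
Proof.
move=> xreg /asboolP[c xE] qs.
have /fin_all_exists[A AE] (i : 'I_(size s)) :
    exists r : 'I_(size s) -> R, q * tofrac s`_i = tofrac (\sum_j r j * s`_j).
  have [y /asboolP[r ->] ->] := qs i.
  by exists (fun j => r j).
pose B := map_mx tofrac (\matrix_(i, j) A i j).
pose v := \col_(i < size s) tofrac s`_i.
have Bv : (q%:M - B) *m v = 0.
  rewrite mulmxBl mul_scalar_mx; apply/eqP; rewrite subr_eq0.
  apply/eqP/colP => i.
  rewrite !mxE AE raddf_sum; apply: eq_bigr => j _.
  by rewrite !mxE /= rmorphM.
have det0 : \det (q%:M - B) = 0.
  have dv : \det (q%:M - B) *: v = 0.
    by rewrite -mul_scalar_mx -mul_adj_mx -mulmxA Bv mulmx0.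
  have [y xy] := @tofrac_regular R _ xreg.
  rewrite -[LHS]mulr1 -xy mulrA xE raddf_sum mulr_sumr big1 ?mul0r // => i _.
  have /colP/(_ i) := dv; rewrite !mxE => dvi.
  by rewrite /= rmorphM mulrCA dvi mulr0.
exists (char_poly (\matrix_(i, j) A i j)); first exact: char_poly_monic.
rewrite rootE -horner_evalE -2!det_map_mx -[X in _ == X]det0; apply/eqP.
congr (\det _); apply/matrixP=> i j.
rewrite !mxE raddfB raddfMn /= map_polyX map_polyC /horner_eval.
by rewrite !hornerE hornerMn hornerX.
Qed.

Lemma conductor_sub_Ann_Ext1 :
  noetherian R -> trace_ideal I -> (exists2 x : R, x \in I & GRing.lreg x) ->
  {subset conductor R <= Ann (Ext (quotmod I) R^o 1)}.
Proof.
move=> noeth Itr [x xI xreg] c /conductorP cP.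
apply/Ann_Ext1_quotP => f fL.
have [q qE] := linear_on_frac xI xreg fL.
have [s sE] := noeth I.
have [|r rE] := cP q.
  apply: (integral_of_stable (s := s) xreg); first by rewrite -sE.
  move=> i; have siI : s`_i \in I by rewrite sE ideal_gen_mem.
  by exists (f s`_i); rewrite ?qE // -sE; apply: trace_ideal_stable.
exists r => a aI; apply: (@tofrac_inj R).
by rewrite !rmorphM /= -rE -mulrA -qE.
Qed.

End TraceConductor.

(** * Proper ideals of a local ring *)

Section Local.
Variable R : comNzRingType.

(** Zorn's lemma on sets of elements of [R].  The empty set is admitted among
    the candidates because it is the union of the empty chain. *)
Lemma proper_sub_maximal (J : ideal R) : 1 \notin J ->
  exists2 J' : ideal R, maximal_ideal J' & {subset J <= J'}.
Proof.
move=> J1; pose setof (K : ideal R) : set R := [set x | x \in K]%classic.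
pose P (A : set R) := A = set0%classic \/
  exists K : ideal R, [/\ A = setof K, {subset J <= K} & 1 \notin K].
have PK (K : ideal R) : {subset J <= K} -> 1 \notin K -> P (setof K).
  by move=> JK K1; right; exists K.
have [|A [PA Amax]] := @Zorn_bigcup R P.
  move=> F FP Ftot; set U := (\bigcup_(X in F) X)%classic.
  have [[A FA [x Ax]]|F0] := pselect (exists2 A, F A & (A !=set0)%classic);
    last first.
    left; rewrite -subset0 => y [X FX Xy].
    by apply: F0; exists X => //; exists y.
  (* The nonempty members of the chain are ideals. *)
  have FK X y : F X -> X y ->
      exists K : ideal R, [/\ X = setof K, {subset J <= K} & 1 \notin K].
    by move=> FX Xy; have [X0|//] := FP X FX; rewrite X0 in Xy.
  have [KA [AE JKA _]] := FK A x FA Ax.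
  pose Up : {pred R^o} := fun y => `[< U y >].
  have UpE y : (y \in Up) = `[< U y >] by [].
  have U_closed : subsemimod_closed Up.
    split; first split.
    - rewrite UpE; apply/asboolP; exists A => //.
      by rewrite AE /setof /= ideal0.
    - move=> y z; rewrite !UpE => /asboolP[Y FY Yy] /asboolP[Z FZ Zz].
      have [X FX [Xy Xz]] : exists2 X, F X & X y /\ X z.
        have [YZ|ZY] := Ftot Y Z FY FZ.
          by exists Z => //; split=> //; apply: YZ.
        by exists Y => //; split=> //; apply: ZY.
      have [K [XE _ _]] := FK X y FX Xy.
      apply/asboolP; exists X => //; move: Xy Xz; rewrite XE /setof /=.
      exact: rpredD.
    - move=> r y; rewrite !UpE => /asboolP[Y FY Yy].
      have [K [YE _ _]] := FK Y y FY Yy.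
      apply/asboolP; exists Y => //; move: Yy; rewrite YE /setof /=.
      exact: rpredZ.
  pose UpM := GRing.isSubmodClosed.Build R R^o Up U_closed.
  pose UK : ideal R := HB.pack Up UpM.
  have UKE y : (y \in UK) = `[< U y >] by [].
  right; exists UK; split.
  - by apply/seteqP; split=> y; rewrite /setof /= UKE => /asboolP.
  - move=> y /JKA yKA; rewrite UKE; apply/asboolP; exists A => //.
    by rewrite AE.
  - rewrite UKE; apply/asboolP => -[X FX X1].
    have [K [XE _ /negP K1]] := FK X _ FX X1.
    by apply: K1; rewrite XE in X1.
case: PA => [A0|[K [AE JK K1]]].
  case: (Amax (setof J)); last exact: PK.
  by rewrite A0; split=> // /(_ _ (ideal0 J)).
exists K => //; split=> // K' KK' K'1 x xK'.
apply: contrapT => xK; apply: (Amax (setof K')); last first.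
  by apply: PK => // y /JK /KK'.
rewrite AE; split; first exact: KK'.
by move=> /(_ x xK').
Qed.

Lemma local_proper_sub (m J : ideal R) : local_ring m -> 1 \notin J ->
  {subset J <= m}.
Proof.
move=> [_ m_uniq] /proper_sub_maximal[J' J'max JJ'] x xJ.
by rewrite -(m_uniq J' J'max) JJ'.
Qed.

End Local.

(** * Grade and nonvanishing of Ext from a fraction outside R *)

Section Grade.
Variables (R : comNzRingType) (I : ideal R).
Local Notation tofrac := (@tofrac R).

Lemma conductor_proper_witness : 1 \notin conductor R ->
  exists2 q : totfrac R, integralOver tofrac q & forall r, q <> tofrac r.
Proof.
move=> /negP C1; apply: contrapT => nq; apply: C1; apply/conductorP => q qi.
apply: contrapT => nr; apply: nq; exists q => // r qr.
by apply: nr; exists r; rewrite rmorph1 mul1r.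
Qed.

Variable q : totfrac R.
Hypothesis qR : forall r, q <> tofrac r.
Hypothesis qI : {in I, forall a, exists r, q * tofrac a = tofrac r}.

(** [q] itself obstructs depth 2: if [q a] and [q b] are in [R], then
    [b (q a) = a (q b)], so if [b] is regular modulo [a] then [a] divides
    [q a] in [R], and cancelling [a] puts [q] in [R]. *)
Lemma no_regular_pair (s : seq R) : regular_seq s -> {subset s <= I} ->
  (size s <= 1)%N.
Proof.
move=> [_ sreg] sI; rewrite leqNgt; apply/negP => s2.
case: s s2 sreg sI => [|a [|b s]] // _ sreg sI.
have areg : GRing.lreg a.
  move=> c d /eqP; rewrite -subr_eq0 -mulrBr => /eqP acd.
  have /asboolP[e] : c - d \in ideal_gen (take 0 [:: a, b & s]).
    apply: (sreg 0%N) => //; rewrite [_ * _]acd.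
    by apply/asboolP; exists (fun=> 0); rewrite big_ord0.
  by rewrite big_ord0 => /eqP; rewrite subr_eq0 => /eqP.
have [u uE] := qI (sI a (mem_head _ _)).
have [v vE] : exists v, q * tofrac b = tofrac v.
  by apply/qI/sI; rewrite !inE eqxx orbT.
have : b * u \in ideal_gen [:: a].
  apply/asboolP; exists (fun=> v); rewrite big_ord1 /=.
  by apply: (@tofrac_inj R); rewrite !rmorphM /= -uE -vE; ring.
move=> /(sreg 1%N isT u)/asboolP[c]; rewrite big_ord1 /= => uc.
have [y ay] := @tofrac_regular R _ areg.
apply: (qR (r := c 0%N)).
by rewrite -[q]mulr1 -ay mulrA uE uc rmorphM -mulrA ay mulr1.
Qed.

(** The class of multiplication by [q] is nonzero: were it multiplication by
    [r] in [R], evaluation at [x] would give [q = r]. *)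
Lemma Ext1_quot_neq0 (x : R) : x \in I -> GRing.lreg x ->
  1 \notin Ann (Ext (quotmod I) R^o 1).
Proof.
move=> xI xreg; apply/negP => /Ann_Ext1_quotP E.
have /choice[f fE] a : exists r, a \in I -> tofrac r = q * tofrac a.
  have [aI|] := boolP (a \in I); last by exists 0.
  by have [r rE] := qI aI; exists r.
have [|r rE] := E f.
  move=> r a b aI bI; apply: (@tofrac_inj R).
  rewrite rmorphD rmorphM /= !fE //; first by rewrite rmorphD rmorphM /=; ring.
  by rewrite -[r * a]/(r *: (a : R^o)); apply: rpredD bI; apply: idealMl.
have [y xy] := @tofrac_regular R _ xreg.
apply: (qR (r := r)); rewrite -[q]mulr1 -xy mulrA -fE // -[f x]mul1r rE //.
by rewrite rmorphM -mulrA xy mulr1.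
Qed.

Lemma grade1 (x : R) : x \in I -> GRing.lreg x -> 1 \notin I -> grade I = 1%N.
Proof.
move=> xI xreg I1.
have I_grade1 : has_grade I 1%N.
  split; last exact: no_regular_pair.
  exists [:: x]; split=> //; last by move=> y; rewrite inE => /eqP->.
  split.
    apply: contra I1 => /asboolP[c ->]; rewrite big_ord1; exact: idealMl.
  case=> // _ a /asboolP[c]; rewrite big_ord0 => /= xa0.
  apply/asboolP; exists (fun=> 0); rewrite big_ord0; apply: xreg.
  by rewrite mulr0.
apply: xget_unique => // n [[s [sreg sI <-]] In].
case: I_grade1 => [[t [treg tI t1]] max1].
by apply/eqP; rewrite eqn_leq max1 //= -t1 In.
Qed.
End Grade.

Theorem proposition5p2 (R : comNzRingType) (m I : ideal R)
    (R_noetherian : noetherian R) (R_local : local_ring m)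
    (I_trace : trace_ideal I)
    (I_regular : exists2 x : R, x \in I & GRing.lreg x) :
  {subset conductor R <= Ann (Ext (quotmod I) R^o 1)} /\
  (conductor R =i m -> has_height I 1 -> D I =i m).
Proof.
have CAnn := conductor_sub_Ann_Ext1 R_noetherian I_trace I_regular.
split=> // Cm [[P [[P1 _] IP _]] _].
have I1 : 1 \notin I by apply: contra P1; apply: IP.
have Im := local_proper_sub R_local I1.
case: R_local => [[m1 mmax] _].
have [|q qi qR] := @conductor_proper_witness R; first by rewrite Cm.
have qI : {in I, forall a, exists r, q * @tofrac R a = tofrac r}.
  move=> a /Im; rewrite -Cm => /conductorP/(_ q qi)[r rE].
  by exists r; rewrite mulrC.
have [x xI xreg] := I_regular.
rewrite /D (grade1 qR qI xI xreg I1) => a; apply/idP/idP; last first.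
  by rewrite -Cm; apply: CAnn.
apply: mmax; first by move=> b; rewrite -Cm; apply: CAnn.
exact: (Ext1_quot_neq0 qR qI xI xreg).
Qed.
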